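(* Let $A=\langle\alpha\rangle$ be an infinite cyclic discrete group and $M$ a nonzero LC $A$-module on which $\alpha$ acts as a contracting automorphism. Suppose that $mM=\{0\}$ for some integer $m\ge1$ and that $M$ is indecomposable (not the topological direct sum of two nonzero closed submodules). Then there exist a prime $p$ and $n\ge1$ such that $M$ is isomorphic, as a topological $A$-module, to $(\mathbf{Z}/p^n\mathbf{Z})(\!(t)\!)$ with its $t$-adic topology and $\alpha$ acting by multiplication by $t$.
   Context: An LC $A$-module is an LCA group with a continuous action of $A$ by topological automorphisms. An automorphism is contracting if $\alpha^n x\to 0$ as $n\to+\infty$ for every $x$. $(\mathbf{Z}/p^n\mathbf{Z})(\!(t)\!)$ denotes the ring of formal Laurent series $\sum_{k\ge k_0}a_kt^k$ with coefficients in $\mathbf{Z}/p^n\mathbf{Z}$. *)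

(* Defs.v *)
From HB Require Import structures.
From mathcomp Require Import all_boot all_order all_algebra.
From mathcomp Require Import all_classical all_reals all_analysis.
Set Implicit Arguments. Unset Strict Implicit. Unset Printing Implicit Defensive.
Import Order.TTheory GRing.Theory Num.Theory.
Local Open Scope classical_set_scope.
Local Open Scope ring_scope.

Definition LCA_group (M : topologicalZmodType) : Prop :=
  hausdorff_space M /\ forall x : M, exists2 K : set M, nbhs x K & compact K.

(* alpha is a topological automorphism of M (additive homeomorphism);
   the LC A-module structure for A = <alpha> infinite cyclic is determined by it. *)
Definition topological_automorphism (M : topologicalZmodType) (alpha : M -> M) : Prop :=
  (forall x y, alpha (x + y) = alpha x + alpha y) /\ continuous alpha /\
  exists2 beta : M -> M, continuous beta & cancel alpha beta /\ cancel beta alpha.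

Definition contracting (M : topologicalZmodType) (alpha : M -> M) : Prop :=
  forall x : M, (fun n : nat => iter n alpha x) @ \oo --> (0 : M).

Definition closed_submodule (M : topologicalZmodType) (alpha : M -> M) (N : set M) : Prop :=
  closed N /\ N 0 /\ (forall x y, N x -> N y -> N (x - y)) /\
  (forall x, N x <-> N (alpha x)).

Definition topological_direct_sum (M : topologicalZmodType) (N1 N2 : set M) : Prop :=
  N1 `&` N2 = [set 0] /\
  (forall x : M, exists a b, N1 a /\ N2 b /\ x = a + b) /\
  exists2 pr : M -> M, continuous pr & forall x, N1 (pr x) /\ N2 (x - pr x).

Definition indecomposable (M : topologicalZmodType) (alpha : M -> M) : Prop :=
  ~ exists N1 N2 : set M,
      [/\ closed_submodule alpha N1, closed_submodule alpha N2,
          (exists2 x, N1 x & x != 0), (exists2 x, N2 x & x != 0)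
        & topological_direct_sum N1 N2].

(* (Z/qZ)((t)) is represented as the functions a : int -> 'Z_q (coefficient
   of t^j) with support bounded below. *)
Definition laurent_series (q : nat) (a : int -> 'Z_q) : Prop :=
  exists k : int, forall j : int, j < k -> a j = 0.

(* phi : M -> (Z/qZ)((t)) is an isomorphism of topological A-modules, where
   (Z/qZ)((t)) carries the t-adic topology (basic neighbourhoods of a are
   a + t^k (Z/qZ)[[t]], i.e. {b | b j = a j for all j < k}) and alpha acts
   by multiplication by t, i.e. (t a)_j = a_(j-1). *)
Definition tadic_nbhd (q : nat) (a : int -> 'Z_q) (k : int) : set (int -> 'Z_q) :=
  [set b | forall j : int, j < k -> b j = a j].

Definition laurent_module_iso (M : topologicalZmodType) (alpha : M -> M)
    (q : nat) (phi : M -> int -> 'Z_q) : Prop :=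
  (forall x y j, phi (x + y) j = phi x j + phi y j) /\
  (forall x, laurent_series (phi x)) /\
  injective phi /\
  (forall a, laurent_series a -> exists x, phi x = a) /\
  (forall x j, phi (alpha x) j = phi x (j - 1)) /\
      (forall x (k : int), nbhs x (phi @^-1` tadic_nbhd (phi x) k)) /\
      (forall x (V : set M), nbhs x V ->
         exists k : int, phi @^-1` tadic_nbhd (phi x) k `<=` V).

(* Main.v *)
(** The subgroup generated by a compact neighbourhood of [0] is compact because
    the exponent is bounded, and by Baire's theorem the powers of [alpha]
    contract it uniformly.  This gives a compact open subgroup [O] with
    [alpha O <= O] whose images [alpha^n O] form a basis of neighbourhoods of
    [0]; so [M] is a finitely generated module over the Laurent series ring in
    [t = alpha], and all algebraic submodules and projections are automatically
    closed and continuous.  Indecomposability forces the exponent to be a prime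
    power [p^(n+1)].  An element [x] of maximal order [p^(n+1)] generates a free
    direct summand, as for bounded abelian [p]-groups, since a power series not
    divisible by [p] is invertible up to a power of [t] modulo [p].  Hence
    [M = (Z/p^(n+1))((t)) x], and the isomorphism reads off the Laurent
    coefficients with respect to [x]. *)
Require Import Defs.
From HB Require Import structures.
From mathcomp Require Import all_boot all_order all_algebra.
From mathcomp Require Import all_classical all_reals all_analysis.
From mathcomp Require Import zify.
Import Order.TTheory GRing.Theory Num.Theory.
Local Open Scope classical_set_scope.
Local Open Scope ring_scope.

Set Implicit Arguments.
Unset Strict Implicit.
Unset Printing Implicit Defensive.

Definition zpow (T : Type) (f g : T -> T) (j : int) (x : T) : T :=
  match j with Posz n => iter n f x | Negz n => iter n.+1 g x end.

Arguments zpow : simpl never.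

(** * Automorphisms contracting a lattice *)

Section Zpow.
Variables (T : Type) (f g : T -> T).
Hypotheses (fK : cancel f g) (gK : cancel g f).
Local Notation P := (zpow f g).

Lemma zpowS j x : P (j + 1) x = f (P j x).
Proof.
case: j => [n|[|n]]; first by rewrite -PoszD addn1.
  by rewrite /zpow /= gK.
rewrite (_ : Negz n.+1 + 1 = Negz n); last by lia.
by rewrite /zpow /= gK.
Qed.

Lemma zpowN1 j x : P (j - 1) x = g (P j x).
Proof. by rewrite -[in RHS](subrK 1 j) zpowS fK. Qed.

Lemma zpowD i j x : P (i + j) x = P i (P j x).
Proof.
elim: i => [|n IHn|n IHn]; first by rewrite add0r.
- by rewrite -addn1 PoszD addrAC !zpowS IHn.
- by rewrite -addn1 PoszD opprD addrAC !zpowN1 IHn.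
Qed.

Lemma zpowK j : cancel (P j) (P (- j)).
Proof. by move=> x; rewrite -zpowD addNr. Qed.

Lemma zpowVK j : cancel (P (- j)) (P j).
Proof. by move=> x; rewrite -zpowD subrr. Qed.

End Zpow.

Section ZpowMorph.
Variables (M : zmodType) (al be : M -> M).
Hypotheses (alD : {morph al : x y / x + y}).
Hypotheses (alK : cancel al be) (beK : cancel be al).
Local Notation P := (zpow al be).

Lemma zpow_morphD j : {morph P j : x y / x + y}.
Proof.
have beD : {morph be : x y / x + y}.
  by move=> x y; apply: (can_inj alK); rewrite alD !beK.
move=> x y; elim: j => [//|n IHn|n IHn].
- by rewrite -addn1 PoszD !(zpowS beK) IHn alD.
- by rewrite -addn1 PoszD opprD !(zpowN1 alK beK) IHn beD.
Qed.

Lemma zpow_morph0 j : P j 0 = 0.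
Proof. by apply: (@addrI _ (P j 0)); rewrite -zpow_morphD !addr0. Qed.

Lemma zpow_morphN j x : P j (- x) = - P j x.
Proof. by apply/eqP; rewrite -addr_eq0 -zpow_morphD addNr zpow_morph0. Qed.

Lemma zpow_morphB j : {morph P j : x y / x - y}.
Proof. by move=> x y; rewrite zpow_morphD zpow_morphN. Qed.

Lemma zpow_morphMn j x n : P j (x *+ n) = P j x *+ n.
Proof.
by elim: n => [|n IHn]; rewrite ?zpow_morph0 // !mulrS zpow_morphD IHn.
Qed.

Lemma zpow_morph_sum j (I : Type) (r : seq I) (Q : pred I) (F : I -> M) :
  P j (\sum_(i <- r | Q i) F i) = \sum_(i <- r | Q i) P j (F i).
Proof. exact: (big_morph _ (zpow_morphD j) (zpow_morph0 j)). Qed.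

End ZpowMorph.

(** The only interface between topology and algebra. [O] stands for a compact open subgroup filtered
    by the [al^n O]; [lat_complete] sums the series of [al^i y_i], and [lat_finite] says that
    [O / al O] is finite. *)
Record contraction_lattice (M : zmodType) (al be : M -> M) (O : set M) : Prop :=
{
  lat_morph : {morph al : x y / x + y};
  lat_alK : cancel al be;
  lat_beK : cancel be al;
  lat0 : O 0;
  latB : forall x y, O x -> O y -> O (x - y);
  lat_al : forall x, O x -> O (al x);
  lat_absorb : forall x, exists k : nat, O (zpow al be k x);
  lat_sep : forall x, (forall n : nat, O (zpow al be (- n%:Z) x)) -> x = 0;
  lat_complete : forall y : nat -> M, (forall i, O (y i)) ->
    exists s, forall n : nat,
      O (zpow al be (- n%:Z) (s - \sum_(i < n) zpow al be i (y i)));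
  lat_finite : exists2 F : seq M, (forall f, f \in F -> O f) &
    forall y, O y -> exists2 f, f \in F & O (be (y - f))
}.

(** * Power series in [al] acting on the group *)

Section Lattice.
Variables (M : zmodType) (al be : M -> M) (O : set M).
Hypothesis L : contraction_lattice al be O.
Local Notation P := (zpow al be).

Let alK := lat_alK L.
Let beK := lat_beK L.
Let PD := zpowD alK beK.
Let zpow_add := zpow_morphD (lat_morph L) alK beK.
Let zpow0r := zpow_morph0 (lat_morph L) alK beK.
Let zpowN := zpow_morphN (lat_morph L) alK beK.
Let zpowB := zpow_morphB (lat_morph L) alK beK.
Let zpowMn := zpow_morphMn (lat_morph L) alK beK.
Let zpow_sum := zpow_morph_sum (lat_morph L) alK beK.

Lemma al0 : al 0 = 0.
Proof. by apply: (@addrI _ (al 0)); rewrite -(lat_morph L) !addr0. Qed.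

Lemma alN x : al (- x) = - al x.
Proof. by apply/eqP; rewrite -addr_eq0 -(lat_morph L) addNr al0. Qed.

Lemma zpow1 x : P 1 x = al x. Proof. by []. Qed.

Lemma lat_raise i j x : i <= j -> O (P i x) -> O (P j x).
Proof.
move=> lij; have -> : j = (`|j - i|%N)%:Z + i by lia.
rewrite PD; move: (P i x) => y; elim: (`|j - i|%N) => [//|n IHn] Oy.
by rewrite -addn1 PoszD (zpowS beK); apply: (lat_al L); exact: IHn.
Qed.

Lemma latN x : O x -> O (- x).
Proof.
by move=> Ox; rewrite -sub0r; apply: (latB L) => //; exact: (lat0 L).
Qed.

Lemma latD x y : O x -> O y -> O (x + y).
Proof.
by move=> Ox Oy; rewrite -[y]opprK; apply: (latB L) => //; exact: latN.
Qed.

Lemma latMn x n : O x -> O (x *+ n).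
Proof.
move=> Ox; elim: n => [|n IHn]; first by rewrite mulr0n; exact: (lat0 L).
by rewrite mulrS; exact: latD.
Qed.

(* [u n] tends to [y] as fast as [al^n O] shrinks to [0], up to a shift. *)
Definition lat_lim (u : nat -> M) (y : M) : Prop :=
  exists k : int, forall n : nat, O (P (k - n%:Z) (y - u n)).

Lemma lat_lim_unique u y y' : lat_lim u y -> lat_lim u y' -> y = y'.
Proof.
move=> [k Hk] [k' Hk']; apply/eqP; rewrite -subr_eq0; apply/eqP.
set K := Num.max k k'; apply: (can_inj (zpowK alK beK K)); rewrite zpow0r.
apply: (lat_sep L) => n; rewrite -PD.
have -> : y - y' = (y - u n) - (y' - u n) by rewrite opprB addrA subrK.
rewrite zpowB; apply: (latB L).
  by apply: lat_raise (Hk n); rewrite /K; lia.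
by apply: lat_raise (Hk' n); rewrite /K; lia.
Qed.

Lemma lat_limD u v y z : lat_lim u y -> lat_lim v z ->
  lat_lim (fun n => u n + v n) (y + z).
Proof.
move=> [k Hk] [k' Hk']; exists (Num.max k k') => n.
rewrite opprD addrACA zpow_add; apply: latD.
  by apply: lat_raise (Hk n); lia.
by apply: lat_raise (Hk' n); lia.
Qed.

Lemma lat_limP j u y : lat_lim u y -> lat_lim (fun n => P j (u n)) (P j y).
Proof.
move=> [k Hk]; exists (k - j) => n; rewrite -zpowB -PD.
by have -> : k - j - n%:Z + j = k - n%:Z by lia.
Qed.

Lemma lat_lim_shift u y : lat_lim u y -> lat_lim (fun n => u n.+1) y.
Proof. by move=> [k Hk]; exists k => n; apply: lat_raise (Hk n.+1); lia. Qed.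

Lemma lat_lim_cst y : lat_lim (fun=> y) y.
Proof. by exists 0 => n; rewrite subrr zpow0r; exact: (lat0 L). Qed.

Lemma lat_lim0 u y : (forall n, O (P (- n%:Z) (y - u n))) -> lat_lim u y.
Proof. by move=> H; exists 0 => n; rewrite sub0r. Qed.

Definition psum (a : nat -> nat) (z : M) (n : nat) : M :=
  \sum_(i < n) P i z *+ a i.

(** The power series with coefficients [a] at [t = al], applied to [z]. Natural coefficients suffice
    in bounded exponent, where [q.-1] stands for [-1]. By [actP] the limit exists, so the default
    [0] never intervenes. *)
Definition act (a : nat -> nat) (z : M) : M := xget 0 (lat_lim (psum a z)).

Lemma actP a z : lat_lim (psum a z) (act a z).
Proof.
suff [y] : exists y, lat_lim (psum a z) y by exact: xgetI.
(* [z] may lie outside [O]: the series is summed for [al^k z] and pulled back. *)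
have [k Ok] := lat_absorb L z.
have [s Hs] := lat_complete L (fun i => latMn (a i) Ok).
exists (P (- k%:Z) s); exists k%:Z => n; rewrite zpowB -PD.
have -> : k%:Z - n%:Z + - k%:Z = - n%:Z by lia.
rewrite [k%:Z - _]addrC PD -zpowB /psum zpow_sum; move: (Hs n).
congr (O (P _ (_ - _))).
by apply: eq_bigr => i _; rewrite !zpowMn -!PD addrC.
Qed.

Lemma act_unique a z y : lat_lim (psum a z) y -> act a z = y.
Proof. exact: lat_lim_unique (actP a z). Qed.

Lemma eq_act a b z : (forall i, z *+ a i = z *+ b i) -> act a z = act b z.
Proof.
move=> ab; apply: act_unique.
suff -> : psum a z = psum b z by exact: actP.
by apply: funext => n; apply: eq_bigr => i _; rewrite -!zpowMn ab.
Qed.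

Lemma act_zpow a j z : act a (P j z) = P j (act a z).
Proof.
apply: act_unique; have := lat_limP j (actP a z); congr lat_lim.
apply: funext => n; rewrite zpow_sum; apply: eq_bigr => i _.
by rewrite zpowMn -!PD addrC.
Qed.

Lemma act_al a z : act a (al z) = al (act a z).
Proof. by rewrite -!zpow1 act_zpow. Qed.

Lemma actD a : {morph act a : x y / x + y}.
Proof.
move=> x y; apply: act_unique; have := lat_limD (actP a x) (actP a y).
congr lat_lim; apply: funext => n; rewrite -big_split; apply: eq_bigr => i _ /=.
by rewrite zpow_add mulrnDl.
Qed.

Lemma act0r a : act a 0 = 0.
Proof. by apply: (@addrI _ (act a 0)); rewrite -actD !addr0. Qed.

Lemma actN a x : act a (- x) = - act a x.
Proof. by apply/eqP; rewrite -addr_eq0 -actD addNr act0r. Qed.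

Lemma actB a : {morph act a : x y / x - y}.
Proof. by move=> x y; rewrite actD actN. Qed.

Lemma actMn a x n : act a (x *+ n) = act a x *+ n.
Proof. by elim: n => [|n IHn]; rewrite ?act0r // !mulrS actD IHn. Qed.

Lemma act_addl a b z : act (fun i => (a i + b i)%N) z = act a z + act b z.
Proof.
apply: act_unique; have := lat_limD (actP a z) (actP b z).
congr lat_lim; apply: funext => n; rewrite -big_split; apply: eq_bigr => i _ /=.
by rewrite mulrnDr.
Qed.

Lemma act_mull c a z : act (fun i => (c * a i)%N) z = act a z *+ c.
Proof.
elim: c => [|c IHc].
  rewrite mulr0n; apply: act_unique; have := lat_lim_cst 0.
  congr lat_lim; apply: funext => n; by rewrite /psum big1.
by rewrite mulrS -IHc -act_addl; congr act.
Qed.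

Lemma act_step a z : act a z = z *+ a 0%N + al (act (fun i => a i.+1) z).
Proof.
apply: lat_lim_unique (lat_lim_shift (actP a z)) _.
have := lat_limD (lat_lim_cst (z *+ a 0%N))
  (lat_limP 1 (actP (fun i => a i.+1) z)).
congr lat_lim; apply: funext => n; rewrite /psum big_ord_recl /=; congr (_ + _).
rewrite zpow_sum; apply: eq_bigr => i _.
by rewrite zpowMn -PD -PoszD add1n.
Qed.

Lemma act_lat a z : O z -> O (act a z).
Proof.
move=> Oz; have [k Hk] := actP a z.
(* The index [|k|] absorbs the shift [k]: the tail of the series lies in [O]. *)
have H := lat_raise (j := 0) _ (Hk `|k|%N).
rewrite -[act a z](subrK (psum a z `|k|%N)); apply: latD.
  by apply: H; lia.
rewrite /psum; elim/big_ind: _ => [|x y Ox Oy|i _]; first exact: (lat0 L).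
  exact: latD.
by apply: latMn; apply: (lat_raise (i := 0)).
Qed.

Definition cons_seq (c : nat) (a : nat -> nat) (i : nat) : nat :=
  if i is j.+1 then a j else c.

Lemma act_cons c a z : act (cons_seq c a) z = z *+ c + al (act a z).
Proof. by rewrite act_step. Qed.

Lemma act_zero z : act (fun=> 0%N) z = 0.
Proof. by rewrite (act_mull 0 (fun=> 0%N)) mulr0n. Qed.

Lemma act_const z : act (cons_seq 1 (fun=> 0%N)) z = z.
Proof. by rewrite act_cons act_zero al0 addr0. Qed.

(* Cauchy product, organised so that it unfolds along [act_step]. *)
Fixpoint cauchy_prod (a b : nat -> nat) (k : nat) : nat :=
  if k is k'.+1 then (b 0%N * a k + cauchy_prod a (fun i => b i.+1) k')%N
  else (b 0%N * a 0%N)%N.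

Lemma act_cauchy_step a b z : act (cauchy_prod a b) z =
  act a z *+ b 0%N + al (act (cauchy_prod a (fun i => b i.+1)) z).
Proof.
rewrite -act_mull -[al _]add0r -[X in _ + (X + _)](mulr0n z).
rewrite -act_cons -act_addl.
by congr act; apply: funext => -[|k] //=; rewrite addn0.
Qed.

(** Both sides obey the same recursion, so unfolding [n] coefficients of [b] puts their difference
    in [al^n O]; [lat_sep] concludes. *)
Lemma act_act a b z : act b (act a z) = act (cauchy_prod a b) z.
Proof.
wlog Oz : z / O z.
  move=> H; have [k Ok] := lat_absorb L z.
  by apply: (can_inj (zpowK alK beK k)); rewrite -!act_zpow H.
apply/eqP; rewrite -subr_eq0; apply/eqP; apply: (lat_sep L) => n.
elim: n b => [|n IHn] b.
  by rewrite oppr0; apply: (latB L); do ?apply: act_lat.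
rewrite act_step act_cauchy_step opprD addrACA subrr add0r -alN -(lat_morph L).
rewrite -zpow1 -PD; have -> : - n.+1%:Z + 1 = - n%:Z by lia.
exact: IHn.
Qed.

(** * Submodules over the power series ring *)

(** Submodules over the Laurent series in [al], a purely algebraic notion; [psub_closed] derives
    closedness. *)
Record power_submodule (H : set M) : Prop := {
  psub0 : H 0;
  psubB : forall x y, H x -> H y -> H (x - y);
  psub_act : forall a x, H x -> H (act a x);
  psub_be : forall x, H (al x) -> H x
}.

Section PowerSubmodule.
Variable (H : set M).
Hypothesis sH : power_submodule H.

Lemma psubN x : H x -> H (- x).
Proof.
by move=> Hx; rewrite -sub0r; apply: (psubB sH) => //; exact: (psub0 sH).
Qed.

Lemma psubD x y : H x -> H y -> H (x + y).
Proof.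
by move=> Hx Hy; rewrite -[y]opprK; apply: (psubB sH) => //; exact: psubN.
Qed.

Lemma psubMn x n : H x -> H (x *+ n).
Proof.
move=> Hx; elim: n => [|n IHn]; first exact: (psub0 sH).
by rewrite mulrS; exact: psubD.
Qed.

Lemma psub_al x : H x -> H (al x).
Proof.
move=> Hx; have := psub_act sH (cons_seq 0 (cons_seq 1 (fun=> 0%N))) Hx.
by rewrite act_cons act_const mulr0n add0r.
Qed.

Lemma psub_zpow j x : H (P j x) <-> H x.
Proof.
have HP i y : H y -> H (P i y).
  move=> Hy; elim: i => [//|n IHn|n IHn].
  - by rewrite -addn1 PoszD (zpowS beK); exact: psub_al.
  - rewrite -addn1 PoszD opprD (zpowN1 alK beK); apply: (psub_be sH).
    by rewrite beK.
by split=> [/(HP (- j))|]; [rewrite (zpowK alK beK)|exact: HP].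
Qed.

End PowerSubmodule.

(* Iterating [y = g + al y'] writes [y] as a sum of [al^i g_i] with [g_i] in the
   finite list [G]; collecting equal digits makes it a finite sum of [act]s. *)
Lemma digit_expansion (G : seq M) (Q S : set M) :
  (forall y, Q y -> O y /\ exists2 g, g \in G & Q (be (y - g))) ->
  S 0 -> (forall x y, S x -> S y -> S (x + y)) ->
  (forall a x, S x -> S (act a x)) ->
  (forall g, g \in G -> S g) -> Q `<=` S.
Proof.
move=> QG S0 SD Sact SG y0 Qy0.
have /choice[d Hd] y : exists g, Q y -> g \in G /\ Q (be (y - g)).
  have [Qy|nQ] := pselect (Q y); last by exists 0.
  by have [_ [g gG Qg]] := QG y Qy; exists g.
pose y_ n := iter n (fun y => be (y - d y)) y0.
have Qy n : Q (y_ n).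
  by elim: n => [//|n IHn] /=; have [] := Hd _ IHn.
have dG n : d (y_ n) \in G by have [] := Hd _ (Qy n).
have yE n : y0 = \sum_(i < n) P i (d (y_ i)) + P n (y_ n).
  elim: n => [|n IHn]; first by rewrite big_ord0 add0r.
  rewrite {1}IHn big_ord_recr /= -addrA; congr (_ + _).
  rewrite -addn1 PoszD PD zpow1 beK.
  by rewrite -zpow_add addrC subrK.
have -> : y0 = \sum_(g <- undup G) act (fun i => (d (y_ i) == g)) g.
  apply: (@lat_lim_unique (fun n => \sum_(i < n) P i (d (y_ i)))).
    apply: lat_lim0 => n; rewrite {1}(yE n) addrAC subrr add0r.
    by rewrite (zpowK alK beK); have [] := QG _ (Qy n).
  have : lat_lim
      (fun n => \sum_(g <- undup G) psum (fun i => (d (y_ i) == g)) g n)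
      (\sum_(g <- undup G) act (fun i => (d (y_ i) == g)) g).
    elim: (undup G) => [|g s IHs].
      rewrite big_nil; have := lat_lim_cst 0; congr lat_lim.
      by apply: funext => n; rewrite big_nil.
    rewrite big_cons; have := lat_limD (actP (fun i => (d (y_ i) == g)) g) IHs.
    by congr lat_lim; apply: funext => n; rewrite big_cons.
  congr lat_lim; apply: funext => n; rewrite exchange_big.
  apply: eq_bigr => i _.
  rewrite (bigD1_seq (d (y_ i))) ?mem_undup ?undup_uniq //= eqxx mulr1n.
  by rewrite big1 ?addr0 // => g /negPf; rewrite eq_sym => ->; rewrite mulr0n.
rewrite big_seq; elim/big_ind: _ => // g; rewrite mem_undup => gG.
exact/Sact/SG.
Qed.

(** As [O / al O] is finite, an element of [O] in the closure of [H] expands in powers of [al] with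
    digits from a finite subset of [H], and [digit_expansion] puts it in [H]. *)
Lemma psub_closed H y : power_submodule H ->
  (forall n : nat, exists2 h, H h & O (P (- n%:Z) (y - h))) -> H y.
Proof.
move=> sH clH.
wlog Oy : y clH / O y.
  move=> Hw; have [k Ok] := lat_absorb L y.
  apply/(psub_zpow sH k)/Hw => // n; have [h Hh Oh] := clH n.
  exists (P k h); first exact/psub_zpow.
  rewrite -zpowB -PD; apply: lat_raise Oh; lia.
have [F FO FG] := lat_finite L.
(* [r f] represents the class of [f] modulo [al O] by an element of both [H] and [O], if there is
   one. *)
have /choice[r Hr] f : exists h,
    (exists h', [/\ H h', O h' & O (be (h' - f))]) ->
    [/\ H h, O h & O (be (h - f))].
  have [[h ?]|nh] := pselect (exists h', [/\ H h', O h' & O (be (h' - f))]).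
    by exists h.
  by exists 0 => h; case: (nh h).
have beE z : be z = P (- 1) z by [].
pose good f := `[< exists h', [/\ H h', O h' & O (be (h' - f))] >].
pose Q := [set y | O y /\
  forall n : nat, exists2 h, H h & O (P (- n%:Z) (y - h))].
suff: Q `<=` H by apply.
apply: (@digit_expansion (map r (seq.filter good F)) Q H) => //.
- move=> z [Oz clz]; split=> //.
  have [h Hh Oh] := clz 1%N.
  have Ohl : O h.
    rewrite -[h](subKr z); apply: (latB L) => //.
    by apply: (lat_raise (j := 0) _ Oh).
  have [f fF Of] := FG h Ohl.
  have gf : good f by apply/asboolP; exists h.
  have [Hrf Orf Orf'] := Hr f (asboolP _ gf).
  exists (r f); first by apply: map_f; rewrite mem_filter gf.
  split.
    have -> : z - r f = (z - h) + (h - f) - (r f - f).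
      by rewrite opprB !addrA !subrK.
    rewrite beE zpowB zpow_add; apply: (latB L) => //; exact: latD.
  (* Dividing the remainder by [al] costs one order of precision. *)
  move=> n; have [h' Hh' Oh'] := clz n.+1.
  exists (be (h' - r f)).
    by rewrite beE; apply/psub_zpow => //; exact: (psubB sH).
  rewrite !beE -zpowB -PD opprB addrA subrK.
  by have -> : - n%:Z + -1 = - n.+1%:Z by lia.
- exact: (psub0 sH).
- exact: psubD.
- exact: (psub_act sH).
- move=> g /mapP[f]; rewrite mem_filter => /andP[/asboolP gf _] ->.
  by case: (Hr f gf).
Qed.

(** Modulo [p], the series [a] is a power of [t] times a unit. Rather than inverting it, the proof
    approximates [z] by elements of [D] and uses that [D] is closed. *)
Lemma unit_cancel D p z a : prime p -> power_submodule D -> D (z *+ p) ->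
  D (act a z) -> (exists i, ~~ (p %| a i)%N) -> D z.
Proof.
move=> p_pr sD; wlog Oz : z / O z.
  move=> Hw Dpz Daz ai; have [k Ok] := lat_absorb L z.
  apply/(psub_zpow sD k); apply: Hw ai => //.
    by rewrite -zpowMn; apply/psub_zpow.
  by rewrite act_zpow; apply/psub_zpow.
move=> Dpz Daz [i].
have base b : D (act b z) -> ~~ (p %| b 0)%N -> D z.
  rewrite -prime_coprime // coprime_sym => Dbz cop.
  have b0_gt0 : (0 < b 0)%N.
    case: (b 0%N) cop => //; rewrite /coprime gcd0n => /eqP p1.
    by rewrite p1 in p_pr.
  (* Bezout: [u * b 0 = 1 + p * w], so multiplying by [u] makes the leading coefficient [1] modulo
     [D]. *)
  have /(coprimeP _ b0_gt0)[[u w] /= uw] := cop.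
  pose c i := (u * b i.+1)%N.
  have Dc : D (z + al (act c z)).
    have := psubMn sD u Dbz; rewrite -act_mull act_step.
    have -> : (u * b 0 = 1 + p * w)%N by lia.
    rewrite mulrnDr mulr1n mulrnA -addrA addrCA => DD.
    rewrite -[_ + _](addKr (z *+ p *+ w)) addrC; apply: (psubB sD) => //.
    exact: psubMn.
  (* Modulo [D], [z] is [- al (act c z)], hence lies in every [al^n O]. *)
  apply: psub_closed => // n.
  suff [v [Ov Dv _]] : exists v, [/\ O v, D (z - P n v) & D (v + al (act c v))].
    by exists (z - P n v) => //; rewrite subKr (zpowK alK beK).
  elim: n => [|n [v [Ov Dv DDv]]].
    by exists z; split=> //; rewrite subrr; exact: (psub0 sD).
  exists (- act c v); split; first by apply: latN; exact: act_lat.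
    rewrite -addn1 PoszD PD zpow1 alN zpowN opprK.
    have -> : z + P n (al (act c v)) = z - P n v + P n (v + al (act c v)).
      by rewrite zpow_add addrA subrK.
    by apply: psubD => //; apply/psub_zpow.
  rewrite actN alN -opprD; apply: psubN => //.
  by rewrite -act_al -actD; apply: (psub_act sD).
(* A leading coefficient divisible by [p] contributes an element of [D]; it is removed and the rest
   divided by [al]. *)
elim: i a Daz => [|i IHi] a Daz ai; first exact: base ai.
have [/dvdnP[c a0]|a0] := boolP (p %| a 0)%N; last exact: base a0.
apply: (IHi (fun j => a j.+1)) ai; apply: (psub_be sD).
rewrite -[al _](addKr (z *+ a 0%N)) -act_step addrC; apply: (psubB sD) => //.
by rewrite a0 mulnC mulrnA; exact: psubMn.
Qed.

Lemma psub_trivial : power_submodule [set 0].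
Proof.
split=> //=.
- by move=> x y -> ->; rewrite subrr.
- by move=> a x ->; rewrite act0r.
- by move=> x ax; apply: (can_inj alK); rewrite al0.
Qed.

Definition sum_set (A B : set M) : set M :=
  [set y | exists2 a, A a & B (y - a)].

Lemma psub_sum A B : power_submodule A -> power_submodule B ->
  power_submodule (sum_set A B).
Proof.
move=> sA sB; split.
- by exists 0; [exact: (psub0 sA)|rewrite subrr; exact: (psub0 sB)].
- move=> x y [a Aa Ba] [a' Aa' Ba']; exists (a - a'); first exact: (psubB sA).
  have -> : x - y - (a - a') = (x - a) - (y - a').
    by rewrite !opprB addrACA [RHS]addrACA [- y - a]addrC.
  exact: (psubB sB).
- move=> c x [a Aa Ba]; exists (act c a); first exact: (psub_act sA).
  by rewrite -actB; exact: (psub_act sB).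
- move=> x [a Aa Ba]; exists (be a).
    by apply: (psub_be sA); rewrite beK.
  by apply: (psub_be sB); rewrite (lat_morph L) alN beK.
Qed.

Lemma sum_setl A B : power_submodule B -> A `<=` sum_set A B.
Proof. by move=> sB a Aa; exists a => //; rewrite subrr; exact: (psub0 sB). Qed.

Lemma sum_setr A B : power_submodule A -> B `<=` sum_set A B.
Proof. by move=> sA b Bb; exists 0; rewrite ?subr0 //; exact: (psub0 sA). Qed.

(** The Laurent series module generated by [x], with the denominator [al^k] cleared. *)
Definition cyclic_sub (x : M) : set M :=
  [set y | exists (k : nat) (a : nat -> nat), P k y = act a x].

Lemma act_shift (k : nat) a x : exists b, P k (act a x) = act b x.
Proof.
elim: k => [|k [b IHk]]; first by exists a.
exists (cons_seq 0 b); rewrite act_cons mulr0n add0r -IHk.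
by rewrite -addn1 PoszD (zpowS beK).
Qed.

Lemma psub_cyclic x q : (0 < q)%N -> x *+ q = 0 ->
  power_submodule (cyclic_sub x).
Proof.
move=> q_gt0 xq; split.
- by exists 0%N, (fun=> 0%N); rewrite act_zero zpow0r.
- move=> y z [k [a ya]] [l [b zb]].
  have [a' Ea] := act_shift l a x; have [b' Eb] := act_shift k b x.
  (* [k + l] gives a common denominator, and [q.-1] acts as [-1] because [q] kills [x]. *)
  exists (k + l)%N, (fun i => (a' i + q.-1 * b' i)%N).
  rewrite act_addl act_mull zpowB; congr (_ + _).
    by rewrite -Ea -ya -PD -PoszD addnC.
  rewrite -Eb -zb -PD -PoszD.
  apply/eqP; rewrite eq_sym -addr_eq0 -mulrSr prednK //.
  by rewrite PoszD PD zb Eb -actMn xq act0r.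
- move=> c y [k [a ya]]; exists k, (cauchy_prod a c).
  by rewrite -act_zpow ya act_act.
- move=> y [k [a ya]]; exists k.+1, a.
  by rewrite -addn1 PoszD PD zpow1.
Qed.

Lemma cyclic_self x : cyclic_sub x x.
Proof. by exists 0%N, (cons_seq 1 (fun=> 0%N)); rewrite act_const. Qed.

(** Uniformity principle: finitely many elements generate [O] over power series, and one member of
    the increasing chain contains them all. *)
Lemma lat_bounded (S : nat -> set M) :
  (forall k, S k 0) -> (forall k x y, S k x -> S k y -> S k (x + y)) ->
  (forall k a x, S k x -> S k (act a x)) ->
  (forall k l, (k <= l)%N -> S k `<=` S l) ->
  (forall x, O x -> exists k, S k x) -> exists k, O `<=` S k.
Proof.
move=> S0 SD Sact Smono SO; have [F FO FG] := lat_finite L.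
suff [k Fk] : exists k, forall f, f \in F -> S k f.
  exists k; apply: (@digit_expansion F O (S k)) => //; last exact: Sact.
    by move=> y Oy; split=> //; exact: FG.
  exact: SD.
clear FG; elim: F FO => [|f F IHF] FO; first by exists 0%N.
have [|k Hk] := IHF; first by move=> g gF; apply: FO; rewrite inE gF orbT.
have [l Hl] := SO f (FO f (mem_head _ _)).
exists (maxn k l) => g; rewrite inE => /orP[/eqP->|/Hk].
  by apply: Smono Hl; exact: leq_maxr.
by apply: Smono; exact: leq_maxl.
Qed.

(** One [k] bounds the components of all [y] in [O]; this makes the projections continuous. *)
Lemma lat_split A B : power_submodule A -> power_submodule B ->
  (forall y, sum_set A B y) ->
  exists k : nat, forall y, O y ->
    exists a, [/\ A a, B (y - a), O (P k a) & O (P k (y - a))].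
Proof.
move=> sA sB AB; apply: (@lat_bounded (fun k : nat => [set y |
    exists a, [/\ A a, B (y - a), O (P k a) & O (P k (y - a))]])).
- move=> k; exists 0; rewrite subr0 zpow0r.
  by split; [exact: (psub0 sA)|exact: (psub0 sB)|exact: (lat0 L)..].
- move=> k x y [a [Aa Ba Oa Oa']] [b [Ab Bb Ob Ob']]; exists (a + b).
  rewrite opprD addrACA; split; [exact: psubD|exact: psubD| |].
    by rewrite zpow_add; exact: latD.
  by rewrite zpow_add; exact: latD.
- move=> k c x [a [Aa Ba Oa Oa']]; exists (act c a).
  rewrite -actB -!act_zpow.
  by split; [exact: (psub_act sA)|exact: (psub_act sB)|exact: act_lat..].
- move=> k l kl y [a [Aa Ba Oa Oa']]; exists a; split=> //.
    by apply: lat_raise Oa; lia.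
  by apply: lat_raise Oa'; lia.
- move=> y _; have [a Aa Ba] := AB y.
  have [k Ok] := lat_absorb L a; have [l Ol] := lat_absorb L (y - a).
  exists (maxn k l), a; split=> //.
    by apply: lat_raise Ok; lia.
  by apply: lat_raise Ol; lia.
Qed.

(** * Free cyclic summands generated by elements of maximal order *)

Section MaximalOrder.
Variables (p n : nat) (x : M).
Hypotheses (p_pr : prime p) (pn0 : forall y : M, y *+ (p ^ n.+1) = 0).
Hypothesis (xn : x *+ (p ^ n) <> 0).

Let q_gt0 : (0 < p ^ n.+1)%N. Proof. by rewrite expn_gt0 prime_gt0. Qed.
Let psC z : power_submodule (cyclic_sub z).
Proof. exact: psub_cyclic (pn0 z). Qed.

(** If some [a i] were prime to [p], [unit_cancel] with [D = 0], applied to [p^n x], would give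
    [p^n x = 0]. *)
Lemma act_torsion a : act a x *+ (p ^ n) = 0 -> forall i, (p %| a i)%N.
Proof.
move=> ax i; apply: contrapT => /negP ai; apply: xn.
apply: (@unit_cancel [set 0] p _ a) => //; last by exists i.
- exact: psub_trivial.
- by rewrite -mulrnA -expnSr pn0.
- by rewrite /= actMn.
Qed.

Lemma act_div a z : (forall i, (p %| a i)%N) ->
  act a z = act (fun i => a i %/ p)%N z *+ p.
Proof.
move=> pa; rewrite -act_mull; congr act; apply: funext => i.
by rewrite mulnC divnK.
Qed.

Lemma cyclic_div c : cyclic_sub x c -> c *+ (p ^ n) = 0 ->
  exists2 c', cyclic_sub x c' & c = c' *+ p.
Proof.
move=> [k [a ca]] cn; have /act_torsion pa : act a x *+ (p ^ n) = 0.
  by rewrite -ca -zpowMn cn zpow0r.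
exists (P (- k%:Z) (act (fun i => a i %/ p)%N x)).
  by exists k, (fun i => a i %/ p)%N; rewrite (zpowVK alK beK).
by rewrite -zpowMn -act_div // -ca (zpowK alK beK).
Qed.

(** Freeness of [x]: once [p^e] divides every coefficient, [act_torsion] for the quotients gains
    another factor [p]. *)
Lemma act_inj a : act a x = 0 -> forall i, (p ^ n.+1 %| a i)%N.
Proof.
move=> ax; suff H e : (e <= n.+1)%N -> forall i, (p ^ e %| a i)%N by exact: H.
elim: e => [|e IHe] en i; first by rewrite expn0 dvd1n.
have pe : (0 < p ^ e)%N by rewrite expn_gt0 prime_gt0.
have pa := IHe (ltnW en); rewrite -(divnK (pa i)) expnS dvdn_pmul2r //.
apply: (act_torsion (a := fun j => a j %/ p ^ e)%N).
have -> : (p ^ n = p ^ e * p ^ (n - e))%N by rewrite -expnD subnKC.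
rewrite mulrnA -act_mull.
have -> : (fun j => p ^ e * (a j %/ p ^ e))%N = a.
  by apply: funext => j; rewrite mulnC divnK.
by rewrite ax mul0rn.
Qed.

Lemma maximal_disjoint (C : set M) :
  exists2 N, power_submodule N /\ (forall y, N y -> C y -> y = 0) &
  forall N', power_submodule N' -> N `<=` N' ->
    (forall y, N' y -> C y -> y = 0) -> N' `<=` N.
Proof.
pose good N := power_submodule N /\ (forall y, N y -> C y -> y = 0).
have [F FP Ftot|A [PA Amax]] := @Zorn_bigcup M [set N | N = set0 \/ good N].
  have [[X FX X0]|nF] := pselect (exists2 X, F X & X !=set0); last first.
    left; apply/seteqP; split=> // y [X FX Xy]; apply: nF.
    by exists X => //; exists y.
  have gF Y y : F Y -> Y y -> good Y.
    by move=> FY Yy; have [Y0|//] := FP _ FY; rewrite Y0 in Yy.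
  right; split; last by move=> y [Y FY Yy]; exact: (gF Y y FY Yy).2.
  case: X0 => x0 Xx0; split.
  - by exists X => //; exact: (psub0 (gF X x0 FX Xx0).1).
  - move=> y z [Y FY Yy] [Z FZ Zz]; have [YZ|ZY] := Ftot Y Z FY FZ.
      by exists Z => //; apply: (psubB (gF Z z FZ Zz).1) => //; exact: YZ.
    by exists Y => //; apply: (psubB (gF Y y FY Yy).1) => //; exact: ZY.
  - by move=> a y [Y FY Yy]; exists Y => //; exact: (psub_act (gF Y y FY Yy).1).
  - by move=> y [Y FY Yy]; exists Y => //; exact: (psub_be (gF Y _ FY Yy).1).
have gA : good A.
  case: PA => // A0; case: (Amax [set 0]); last first.
    by right; split; [exact: psub_trivial|move=> y ->].
  by rewrite A0; split=> // /(_ 0 erefl).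
exists A => // N' sN' AN' N'C; apply: contrapT => nN'.
by apply: (Amax N'); [split|right].
Qed.

(* An element of maximal order generates a direct summand: the argument for
   bounded abelian [p]-groups, with [unit_cancel] replacing the fact that
   integers prime to [p] are invertible. *)
Lemma cyclic_complement : exists2 N, power_submodule N &
  (forall y, N y -> cyclic_sub x y -> y = 0) /\
  (forall y, sum_set N (cyclic_sub x) y).
Proof.
have [N [sN NC] Nmax] := maximal_disjoint (cyclic_sub x).
exists N => //; split=> // y; set D := sum_set _ _.
have sD : power_submodule D by exact: psub_sum.
apply: contrapT => nDy.
(* Replacing [y] by [p^e y] for this [e] gives [p y] in [D] with [y] outside [D]. *)
have [e] : exists e, (`[< D (y *+ p ^ e.+1) >]) && ~~ `[< D (y *+ p ^ e) >].
  have ex0 : exists e, `[< D (y *+ p ^ e) >].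
    by exists n.+1; apply/asboolP; rewrite pn0; exact: (psub0 sD).
  case: (ex_minnP ex0) => -[|e] /asboolP De emin.
    by rewrite expn0 mulr1n in De.
  exists e; apply/andP; split; first exact/asboolP.
  by apply/negP => /emin; rewrite ltnn.
case/andP => /asboolP[u Nu Cu] /asboolP nDe.
rewrite expnSr mulrnA in Cu; move: (y *+ p ^ e) Cu nDe {nDy} => {}y Cu nDe.
(* [p^n (p y - u) = - p^n u] lies in both [N] and the cyclic module, hence vanishes. So
   [p y - u = p c], and [z = y - c] satisfies [p z = u] in [N]. *)
have cu0 : (y *+ p - u) *+ p ^ n = 0.
  have yu : (y *+ p - u) *+ p ^ n = - (u *+ p ^ n).
    by rewrite mulrnBl -mulrnA -expnS pn0 sub0r.
  apply: NC; last exact: psubMn.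
  by rewrite yu; apply: psubN => //; exact: psubMn.
have [c Cc uc] := cyclic_div Cu cu0.
pose z := y - c.
have Npz : N (z *+ p) by rewrite mulrnBl -uc subKr.
have Dc : D c by exact: sum_setr.
have nDz : ~ D z by move=> Dz; apply: nDe; rewrite -(subrK c y); exact: psubD.
(* By maximality of [N], it suffices that adjoining [z] creates no new intersection with the cyclic
   module of [x]. *)
apply: nDz; apply: (sum_setl (psC x)); apply: (Nmax (sum_set N (cyclic_sub z))).
- exact: psub_sum.
- exact: sum_setl.
- move=> w [v Nv [k [a wa]]] Cw.
  (* A coefficient prime to [p] would put [z] in [D] by [unit_cancel]; otherwise [act a z] is in [N]
     because [p z] is. *)
  have [[i ai]|pa] := pselect (exists i, ~~ (p %| a i)%N).
    exfalso; apply: nDe; rewrite -(subrK c y); apply: psubD => //.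
    apply: (@unit_cancel D p z a) => //; [exact: sum_setl| |by exists i].
    rewrite -wa; apply/psub_zpow => //.
    apply: (psubB sD); first exact: sum_setr.
    exact: sum_setl.
  apply: NC => //; rewrite -(subrK v w); apply: psubD => //.
  apply/(psub_zpow sN k); rewrite wa act_div; last first.
    by move=> i; apply: contrapT => /negP ai; apply: pa; exists i.
  by rewrite -actMn; exact: (psub_act sN).
- by apply: sum_setr => //; exact: cyclic_self.
Qed.

End MaximalOrder.

End Lattice.

(** * Compact open subgroups of contraction groups *)

Lemma compact_nested (T : topologicalType) (K : set T) (C : nat -> set T) :
  compact K -> C 0%N `<=` K -> (forall n, closed (C n)) ->
  (forall n, C n.+1 `<=` C n) -> (forall n, C n !=set0) ->
  \bigcap_n C n !=set0.
Proof.
move=> cK CK clC CS C0.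
have Cle i j : (i <= j)%N -> C j `<=` C i.
  move=> /subnK <-; elim: (j - i)%N => [|k IHk] //.
  by rewrite addSn; exact: subset_trans (CS _) IHk.
pose F : set_system T := [set A | exists n, C n `<=` A].
have FF : ProperFilter F.
  split.
    by case=> n Cn; case: (C0 n) => x /Cn.
  split.
  - by exists 0%N.
  - move=> A B [i Ai] [j Bj]; exists (maxn i j) => x Cx; split.
      by apply: Ai; apply: Cle Cx; exact: leq_maxl.
    by apply: Bj; apply: Cle Cx; exact: leq_maxr.
  - by move=> A B AB [n An]; exists n; exact: subset_trans AB.
have [|x [_ clx]] := cK F FF; first by exists 0%N.
exists x => n _; apply: clC => B Bx; apply: clx => //.
by exists n.
Qed.

(** If no [A n] had interior, nested closed neighbourhoods in [K] could avoid each [A n] in turn,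
    and compactness would give a point of [K] outside all of them. *)
Lemma baire_compact (T : topologicalType) (K : set T) (x0 : T)
    (A : nat -> set T) :
  hausdorff_space T -> compact K -> nbhs x0 K -> (forall n, closed (A n)) ->
  (forall x, K x -> exists n, A n x) -> exists n (x : T), nbhs x (A n).
Proof.
move=> hT cK Kx0 clA KA; apply: contrapT => noA.
(* The conditions on [nU.2] stand under the existential so that choice yields a total function. *)
have step (nU : nat * set T) : exists V : set T,
    (nU.2 `<=` K) -> (exists x : T, nbhs x nU.2) ->
    [/\ closed V, exists x : T, nbhs x V, V `<=` nU.2 &
        forall x, V x -> ~ A nU.1 x].
  case: nU => n U /=.
  have [[UK [x Ux]]|nU] := pselect (U `<=` K /\ exists x : T, nbhs x U);
    last first.
    by exists set0 => UK Ux; case: nU.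
  have [y Uy nAy] : exists2 y : T, nbhs y U & ~ A n y.
    apply: contrapT => nex; apply: noA; exists n, x.
    have := nbhs_interior Ux; apply: filterS => y Uy; apply: contrapT => nAy.
    by apply: nex; exists y.
  have Ky : nbhs y K by exact: filterS Uy.
  have UAy : nbhs y (U `&` ~` A n).
    apply: filterI => //; apply: open_nbhs_nbhs; split=> //.
    exact: closed_openC.
  have [B By BU] := compact_regular hT cK Ky UAy.
  exists (closure B) => _ _; split.
  - exact: closed_closure.
  - by exists y; apply: filterS By; exact: subset_closure.
  - by move=> z /BU[].
  - by move=> z /BU[].
have [f Hf] := choice step.
have clK : closed K by exact: compact_closed.
pose C := fix C n : set T := if n is k.+1 then f (k, C k) else K.
have HC n : C n `<=` K /\ exists x : T, nbhs x (C n).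
  elim: n => [|n [IH1 IH2]]; first by split=> //; exists x0.
  have [_ ? sub _] := Hf (n, C n) IH1 IH2; split=> //.
  exact: subset_trans sub IH1.
have [x Cx] : \bigcap_n C n !=set0.
  apply: (compact_nested cK) => //.
  - by case=> [//|n]; have [H1 H2] := HC n; have [] := Hf (n, C n) H1 H2.
  - by move=> n; have [H1 H2] := HC n; have [] := Hf (n, C n) H1 H2.
  - by move=> n; have [_ [y Cy]] := HC n; exists y; exact: nbhs_singleton.
have [n An] := KA x (Cx 0%N I).
have [H1 H2] := HC n; have [_ _ _ /(_ x)] := Hf (n, C n) H1 H2.
by apply=> //; exact: (Cx n.+1 I).
Qed.

(** * Neighbourhoods and compact subgroups of topological abelian groups *)

Section TopologicalGroup.
Variable M : topologicalZmodType.
Implicit Types (x y : M) (V : set M).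

Lemma addl_continuous (a : M) : continuous (fun x : M => a + x).
Proof.
move=> x; apply: (@continuous_comp _ _ _ (fun x => (a, x))
  (fun x : M * M => x.1 + x.2)); last exact: add_continuous.
by apply: cvg_pair => /=; [exact: cvg_cst|exact: cvg_id].
Qed.

Lemma nbhs_addl (a x : M) V : nbhs (a + x) V -> nbhs x [set y | V (a + y)].
Proof. exact: addl_continuous. Qed.

Lemma nbhsE0 x V : nbhs x V <-> nbhs 0 [set y | V (x + y)].
Proof.
split=> [Vx|V0]; first by apply: nbhs_addl; rewrite addr0.
have := nbhs_addl (a := - x) (x := x); rewrite addNr => /(_ _ V0).
by apply: filterS => y /=; rewrite addNKr.
Qed.

Lemma nbhs0_sub V : nbhs (0 : M) V ->
  exists2 W, nbhs (0 : M) W & forall x y, W x -> W y -> V (x - y).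
Proof.
move=> V0; have := @sub_continuous M (0, 0) V; rewrite /= subr0 => /(_ V0).
case=> -[A B] /= [A0 B0] AB; exists (A `&` B); first exact: filterI.
by move=> x y [Ax _] [_ By]; exact: (AB (x, y)).
Qed.

(** Complements in [K] of finitely many translates of [V] generate a filter. Without a finite cover
    it is proper, and a cluster point [x] contradicts the removal of [x + V]. *)
Lemma compact_translates (K : set M) V : compact K -> nbhs (0 : M) V ->
  exists2 F : seq M, (forall f, f \in F -> K f) &
    forall y, K y -> exists2 f, f \in F & V (y - f).
Proof.
move=> cK V0.
pose F0 := [set A : set M | exists2 F : seq M, (forall f, f \in F -> K f) &
  forall y, K y -> (forall f, f \in F -> ~ V (y - f)) -> A y].
apply: contrapT => nF.
have FF : ProperFilter F0.
  split.
    case=> F FK FV; apply: nF; exists F => // y Ky; apply: contrapT => nf.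
    by apply: (FV y Ky) => f fF Vf; apply: nf; exists f.
  split.
  - by exists [::].
  - move=> A B [F FK FA] [G GK GB]; exists (F ++ G).
      by move=> f; rewrite mem_cat => /orP[/FK|/GK].
    move=> y Ky nV; split; [apply: FA|apply: GB] => // f fF; apply: nV.
      by rewrite mem_cat fF.
    by rewrite mem_cat fF orbT.
  - move=> A B AB [F FK FA]; exists F => // y Ky nV.
    by apply: AB; exact: FA.
have [|x [Kx clx]] := cK F0 FF; first by exists [::].
have [||y [ny Vy]] := clx [set y | ~ V (y - x)] [set y | V (y - x)].
- exists [:: x]; first by move=> f; rewrite inE => /eqP->.
  by move=> y Ky; apply; rewrite inE.
- apply/nbhsE0; apply: filterS V0 => y /=.
  by rewrite addrC addKr.
- exact: ny.
Qed.

Lemma open_subgroup_closed (L : set M) : nbhs (0 : M) L ->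
  (forall x y, L x -> L y -> L (x - y)) -> closed L.
Proof.
move=> L0 LB x /(_ [set y | L (y - x)]) [|y [Ly Lyx]].
  apply/nbhsE0; apply: filterS L0 => y /=.
  by rewrite addrC addKr.
by rewrite -(subKr y x); exact: LB.
Qed.

(* If [V] is a compact neighbourhood of [0] then [V + V <= F + V] with [F]
   finite, so all iterated sums of [V] stay in [<F> + V], and [<F>] is finite
   because the exponent is bounded. *)
Lemma bounded_compact_open_subgroup (V : set M) (m : nat) :
  hausdorff_space M -> compact V -> nbhs (0 : M) V -> (0 < m)%N ->
  (forall x : M, x *+ m = 0) ->
  exists K, [/\ compact K, nbhs (0 : M) K &
                forall x y, K x -> K y -> K (x - y)].
Proof.
move=> hM cV V0 m_gt0 xm.
have cVV : compact ((fun x : M * M => x.1 + x.2) @` (V `*` V)).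
  apply: continuous_compact; last exact: compact_setX.
  by apply: continuous_subspaceT; exact: add_continuous.
have [F _ FV] := compact_translates cVV V0.
(* [X s] is [V] plus the subgroup generated by [s]; multiples count only modulo [m], so it is a
   finite union of translates. *)
pose X := fix X (s : seq M) : set M :=
  if s is f :: s' then [set y | exists k : nat, X s' (y - f *+ k)] else V.
have cX s : compact (X s).
  elim: s => [//|f s IHs].
  have -> : X (f :: s) =
      \big[setU/set0]_(k <- iota 0 m) ((fun y => f *+ k + y) @` X s).
    rewrite -bigcup_seq; apply/seteqP; split=> [y [k Xk]|y [k _ [z Xz <-]]].
      exists (k %% m)%N; first by rewrite /= mem_iota add0n ltn_mod m_gt0.
      exists (y - f *+ k) => //; rewrite {2}(divn_eq k m) mulrnDr mulnC mulrnA.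
      by rewrite xm mul0rn add0r addrC subrK.
    by exists k; rewrite addrC addKr.
  apply: bigsetU_compact => k _; apply: continuous_compact => //.
  by apply: continuous_subspaceT; exact: addl_continuous.
have VX s : V `<=` X s.
  elim: s => [//|f s IHs] v Vv; exists 0%N.
  by rewrite mulr0n subr0; exact: IHs.
have XD s f y : f \in s -> X s y -> X s (y + f).
  elim: s y => [//|g s IHs] y; rewrite inE => /orP[/eqP-> [k Xk]|fs [k Xk]].
    by exists k.+1; rewrite mulrS opprD addrA addrK.
  by exists k; rewrite addrAC; exact: IHs.
have XV s y v : X s y -> V v -> exists2 f, f \in F & X s (y + v - f).
  elim: s y => [|g s IHs] y.
    by move=> Vy Vv; apply: FV; exists (y, v).
  move=> [k Xk] Vv; have [f fF Xf] := IHs _ Xk Vv; exists f => //.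
  exists k; suff -> : y + v - f - g *+ k = y - g *+ k + v - f by [].
  by rewrite addrAC [y + v - _]addrAC.
pose L := [set y | exists2 s : seq M, (forall v, v \in s -> V v) &
                                      y = \sum_(v <- s) v].
have L0 : L 0 by exists [::]; rewrite ?big_nil.
have LD x y : L x -> L y -> L (x + y).
  move=> [s sV ->] [t tV ->]; exists (s ++ t); last by rewrite big_cat.
  by move=> v; rewrite mem_cat => /orP[/sV|/tV].
have LM x k : L x -> L (x *+ k).
  by move=> Lx; elim: k => [//|k IHk]; rewrite mulrS; exact: LD.
have LB x y : L x -> L y -> L (x - y).
  move=> Lx Ly; apply: LD => //; suff -> : - y = y *+ m.-1 by exact: LM.
  by apply/eqP; rewrite eq_sym -addr_eq0 -mulrSr prednK // xm.
have VL : V `<=` L.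
  move=> v Vv; exists [:: v]; last by rewrite big_seq1.
  by move=> w; rewrite inE => /eqP->.
have nL : nbhs (0 : M) L by exact: filterS V0.
exists L; split=> //.
apply: (subclosed_compact _ (cX F)); first exact: open_subgroup_closed.
move=> _ [s sV ->]; elim: s sV => [|v s IHs] sV.
  by rewrite big_nil; apply: VX; exact: nbhs_singleton.
rewrite big_cons addrC.
have Xs : X F (\sum_(w <- s) w).
  by apply: IHs => w ws; apply: sV; rewrite inE ws orbT.
have [f fF Xf] := XV F _ v Xs (sV v (mem_head _ _)).
by rewrite -(subrK f (_ + v)); exact: XD.
Qed.

End TopologicalGroup.

(** * Uniform contraction and construction of the lattice *)

Section Contraction.
Variables (M : topologicalZmodType) (al be : M -> M).
Hypotheses (hM : hausdorff_space M) (alD : {morph al : x y / x + y}).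
Hypotheses (cal : continuous al) (cbe : continuous be).
Hypotheses (alK : cancel al be) (beK : cancel be al) (contr : contracting al).
Local Notation P := (zpow al be).

Let PD := zpowD alK beK.
Let zpow_add := zpow_morphD alD alK beK.
Let zpow0r := zpow_morph0 alD alK beK.
Let zpowB := zpow_morphB alD alK beK.

Lemma zpow_continuous j : continuous (P j).
Proof.
elim: j => [|n IHn|n IHn] x; first exact: cvg_id.
- rewrite (_ : P n.+1 = al \o P n).
    by apply: continuous_comp; [exact: IHn|exact: cal].
  by apply: funext => y; rewrite -addn1 PoszD (zpowS beK).
- rewrite (_ : P (- n.+1%:Z) = be \o P (- n%:Z)).
    by apply: continuous_comp; [exact: IHn|exact: cbe].
  by apply: funext => y; rewrite -addn1 PoszD opprD (zpowN1 alK beK).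
Qed.

Lemma zpow_cvg0 x V : nbhs (0 : M) V ->
  exists N, forall k : nat, (N <= k)%N -> V (P k x).
Proof. by move=> /(contr x)[N _ HN]; exists N => k Nk; exact: HN. Qed.

(** By Baire some [A n] has an interior point; subtracting it gives a neighbourhood [U] of [0] with
    [al^k U] inside [W] for all [k >= n]. Compactness of [K] then bounds the time needed to enter
    [U]. *)
Lemma contracting_uniform (K0 K W : set M) :
  compact K0 -> nbhs (0 : M) K0 -> compact K -> nbhs (0 : M) W ->
  exists N, forall k : nat, (N <= k)%N -> forall x, K x -> W (P k x).
Proof.
move=> cK0 K00 cK W0.
have [W1 W10 W1W] := nbhs0_sub W0.
have [B B0 BW1] := compact_regular hM cK0 K00 W10.
pose A n := [set x | forall k : nat, (n <= k)%N -> closure B (P k x)].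
have clA n : closed (A n).
  have -> : A n = \bigcap_(k in [set k | (n <= k)%N]) (P k%:Z @^-1` closure B).
    by apply/seteqP; split=> x Hx k; exact: Hx.
  apply: closed_bigI => k _; apply: preimage_closed; last exact: closed_closure.
  by move=> x _; exact: zpow_continuous.
have KA x : K0 x -> exists n, A n x.
  move=> _; have [N HN] := zpow_cvg0 x B0; exists N => k Nk.
  by apply: subset_closure; exact: HN.
have [n [x Ax]] := baire_compact hM cK0 K00 clA KA.
pose U := [set u | A n (x + u)].
have U0 : nbhs (0 : M) U := (nbhsE0 x (A n)).1 Ax.
have UW u k : U u -> (n <= k)%N -> W (P k u).
  move=> Uu nk; have -> : P k u = P k (x + u) - P k x.
    by rewrite zpow_add addrC addKr.
  apply: W1W; apply: BW1; first exact: Uu.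
  exact: (nbhs_singleton Ax).
have /compact_near_coveringP /(_ nat \oo (fun k x => W (P k x))) := cK.
case=> [y Ky|N _ HN]; last by exists N => k Nk x' Kx'; apply: HN.
have [j Hj] := zpow_cvg0 y (nbhs_interior U0).
have nj : nbhs y (P j @^-1` U) by apply: zpow_continuous; exact: Hj.
exists (P j @^-1` U, [set k | (n + j <= k)%N]).
  by split=> //; exists (n + j)%N.
move=> [z k] /= [Uz nk].
have -> : Posz k = (k - j)%N%:Z + j%:Z by lia.
by rewrite PD; apply: UW => //; lia.
Qed.

Lemma contraction_latticeP (K : set M) :
  compact K -> nbhs (0 : M) K -> (forall x y, K x -> K y -> K (x - y)) ->
  exists2 O, contraction_lattice al be O &
    nbhs (0 : M) O /\ forall V, nbhs (0 : M) V ->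
      exists n : nat, forall x, O (P (- n%:Z) x) -> V x.
Proof.
(* [O] is the largest [al]-stable subset of [K]. It is a neighbourhood of [0] since uniform
   contraction leaves only finitely many conditions to check. *)
move=> cK K0 KB; pose O := [set x | forall k : nat, K (P k x)].
have clK : closed K by exact: compact_closed.
have OK : O `<=` K by move=> x /(_ 0%N).
have clO : closed O.
  have -> : O = \bigcap_k (P k%:Z @^-1` K).
    by apply/seteqP; split=> x Hx k; [move=> _; exact: Hx|exact: (Hx k I)].
  apply: closed_bigI => k _; apply: preimage_closed => // x _.
  exact: zpow_continuous.
have cO : compact O by exact: subclosed_compact OK.
have nO : nbhs (0 : M) O.
  have [N HN] := contracting_uniform cK K0 cK K0.
  have : nbhs (0 : M) [set x | forall k : nat, (k < N)%N -> K (P k x)].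
    elim: N {HN} => [|N IHN]; first by apply: filterS filterT => x _ k.
    have KN : nbhs (0 : M) (P N @^-1` K).
      by apply: zpow_continuous; rewrite zpow0r.
    apply: filterS (filterI IHN KN) => x [Hx KNx] k.
    by rewrite ltnS leq_eqVlt => /orP[/eqP->|]; [|exact: Hx].
  move=> H; apply: filterS (filterI K0 H) => x [Kx Hx] k.
  by have [kN|Nk] := ltnP k N; [exact: Hx|exact: HN].
have basis V : nbhs (0 : M) V ->
    exists n : nat, forall x, O (P (- n%:Z) x) -> V x.
  move=> V0; have [N HN] := contracting_uniform cK K0 cO V0.
  by exists N => x /(HN N (leqnn N)); rewrite (zpowVK alK beK).
have O0 : O 0 by exact: nbhs_singleton.
have OB x y : O x -> O y -> O (x - y).
  by move=> Ox Oy k; rewrite zpowB; exact: KB.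
have Oal x : O x -> O (al x).
  by move=> Ox k; have := Ox k.+1; rewrite -addn1 PoszD PD.
exists O => //; split=> //.
- by move=> x; have [N HN] := zpow_cvg0 x nO; exists N; exact: HN.
- move=> x Hx; apply/esym; apply: hM => A B A0 Bx.
  exists x; split; last exact: nbhs_singleton.
  by have [n Hn] := basis A A0; exact: Hn.
- move=> y Oy.
  (* The [C n] are nested cosets of [al^n O]; a common point is the required sum. *)
  pose C n := [set s | O (P (- n%:Z) (s - \sum_(i < n) P i (y i)))].
  have [s Cs] : \bigcap_n C n !=set0.
    apply: (compact_nested cO) => [s|n|n s|n].
    - by rewrite /C /= big_ord0 subr0.
    - pose S := \sum_(i < n) P i (y i).
      have -> : C n = (fun s => - S + s) @^-1` (P (- n%:Z) @^-1` O).
        by apply/seteqP; split=> s; rewrite /C /= addrC.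
      apply: preimage_closed; first by move=> s _; exact: addl_continuous.
      by apply: preimage_closed clO => s _; exact: zpow_continuous.
    - rewrite /C /= big_ord_recr /= => Os.
      set S := \sum_(i < n) _ in Os *.
      have -> : s - S = (s - (S + P n (y n))) - - P n (y n).
        by rewrite opprD opprK addrA subrK.
      rewrite zpowB; apply: (OB _ _).
        have -> : - n%:Z = 1 + - n.+1%:Z by lia.
        by rewrite PD; exact: Oal.
      rewrite (zpow_morphN alD alK beK) (zpowK alK beK) -sub0r.
      exact: OB.
    - by exists (\sum_(i < n) P i (y i)); rewrite /C /= subrr zpow0r.
  by exists s => n; exact: Cs.
- have := compact_translates cO (V := [set x | O (be x)]); apply.
  by apply: cbe; rewrite (_ : be 0 = 0) //; exact: (zpow0r (- 1)).
Qed.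

End Contraction.

(** * Primary decomposition and Laurent expansions *)

Lemma mulrn_modn (M : zmodType) (x : M) d k :
  x *+ d = 0 -> x *+ (k %% d) = x *+ k.
Proof.
by move=> xd; rewrite {2}(divn_eq k d) mulrnDr mulnC mulrnA xd mul0rn add0r.
Qed.

Section PrimaryDecomposition.
Variable (M : topologicalZmodType).

Lemma mulrn_continuous k : continuous (fun x : M => x *+ k).
Proof.
elim: k => [|k IHk] x; first exact: cvg_cst.
rewrite (_ : (fun x : M => x *+ k.+1) = (fun z : M * M => z.1 + z.2) \o
    (fun x => (x, x *+ k))); last by apply: funext => y; rewrite mulrS.
apply: continuous_comp; last exact: add_continuous.
by apply: cvg_pair; [exact: cvg_id|exact: IHk].
Qed.

Lemma torsion_submodule (al : M -> M) k :
  hausdorff_space M -> topological_automorphism al ->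
  closed_submodule al [set x | x *+ k = 0].
Proof.
move=> hM [alD [cal [be cbe [alK beK]]]].
have al0 : al 0 = 0 by apply: (@addrI _ (al 0)); rewrite -alD !addr0.
have alMn x : al (x *+ k) = al x *+ k.
  by elim: k => [//|k IHk]; rewrite !mulrS alD IHk.
split; last split; last split; rewrite /=.
- have -> : [set x : M | x *+ k = 0] = (fun x => x *+ k) @^-1` [set 0] by [].
  apply: preimage_closed; first by move=> x _; exact: mulrn_continuous.
  by apply: compact_closed => //; exact: compact_set1.
- by rewrite mul0rn.
- by move=> x y xk yk; rewrite mulrnBl xk yk subrr.
- move=> x; rewrite -alMn; split=> [->//|axk].
  by apply: (can_inj alK); rewrite al0.
Qed.

Lemma indecomposable_exponent (al : M -> M) m :
  hausdorff_space M -> topological_automorphism al -> indecomposable al ->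
  (exists x : M, x != 0) -> (0 < m)%N -> (forall x : M, x *+ m = 0) ->
  exists p n, [/\ prime p, forall x : M, x *+ (p ^ n.+1) = 0 &
                  exists x : M, x *+ (p ^ n) <> 0].
Proof.
move=> hM aut ind [x0 x0n0] m0 m_tors.
(* The least exponent [k] is used, so that both primary parts below are nonzero. *)
have exm : exists k, (0 < k)%N && `[< forall x : M, x *+ k = 0 >].
  by exists m; rewrite m0; apply/asboolP.
case: (ex_minnP exm) => k /andP[k0 /asboolP k_tors] kmin {m m0 m_tors exm}.
have k1 : (1 < k)%N.
  case: k k0 k_tors {kmin} => [//|[|//]] _ /(_ x0); rewrite mulr1n => x00.
  by rewrite x00 eqxx in x0n0.
have small d : (0 < d < k)%N -> exists x : M, x *+ d <> 0.
  move=> /andP[d0 dk]; apply: contrapT => nx; move: dk; rewrite ltnNge.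
  rewrite kmin // d0; apply/asboolP => x; apply: contrapT => xd.
  by apply: nx; exists x.
pose p := pdiv k; have p_pr : prime p by exact: pdiv_prime.
have [r cop kE] := pfactor_coprime p_pr k0.
set e := logn p k in kE.
have e0 : (0 < e)%N by rewrite -pfactor_dvdn // expn1 pdiv_dvd.
have q0 : (0 < p ^ e)%N by rewrite expn_gt0 prime_gt0.
have r0 : (0 < r)%N by case: (r) kE k0 => // ->.
have q1 : (1 < p ^ e)%N by rewrite -{1}(expn0 p) ltn_exp2l // prime_gt1.
have [r1|r_le1] := ltnP 1 r; last first.
  have rE : r = 1%N by apply/eqP; rewrite eqn_leq r_le1.
  rewrite rE mul1n in kE; exists p, e.-1; split=> //.
    by rewrite prednK // -kE.
  have [|x xd] := small (p ^ e.-1)%N; last by exists x.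
  by rewrite kE expn_gt0 prime_gt0 //= ltn_exp2l ?prime_gt1 // prednK.
(* Multiplication by [c] is the continuous projection onto the [p^e]-torsion along the
   [r]-torsion. *)
case: ind; set c := chinese (p ^ e) r 1 0.
have copq : coprime (p ^ e) r by rewrite coprimeXl.
have c1 : c = 1 %[mod p ^ e] by exact: chinese_modl.
have c0 : (r %| c)%N by rewrite /dvdn chinese_modr // mod0n.
exists [set x | x *+ (p ^ e) = 0], [set x | x *+ r = 0]; split.
- exact: torsion_submodule.
- exact: torsion_submodule.
- have [|x xr] := small r; first by rewrite r0 kE ltn_Pmulr.
  exists (x *+ r); last exact/eqP.
  by rewrite /= -mulrnA -kE k_tors.
- have [|x xq] := small (p ^ e)%N; first by rewrite q0 kE ltn_Pmull.
  exists (x *+ (p ^ e)); last exact/eqP.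
  by rewrite /= -mulrnA mulnC -kE k_tors.
have pr1 (x : M) : x *+ c *+ (p ^ e) = 0.
  case/dvdnP: c0 => c' ->; rewrite -mulrnA -mulnA -kE mulnC mulrnA.
  by rewrite k_tors mul0rn.
have pr2 (x : M) : (x - x *+ c) *+ r = 0.
  have xq : x *+ r *+ (p ^ e) = 0 by rewrite -mulrnA -kE k_tors.
  rewrite mulrnBl -mulrnA mulnC mulrnA -(mulrn_modn c xq) c1 mulrn_modn //.
  by rewrite mulr1n subrr.
split.
  apply/seteqP; split=> [x [/= xq xr]|x ->]; last by rewrite /= !mul0rn.
  rewrite -[x]mulr1n -(mulrn_modn 1 xq) -c1 mulrn_modn //.
  by case/dvdnP: c0 => c' ->; rewrite mulnC mulrnA xr mul0rn.
split; last first.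
  by exists (fun x => x *+ c) => [|x]; [exact: mulrn_continuous|split].
move=> x; exists (x *+ c), (x - x *+ c); split; first exact: pr1.
by split; [exact: pr2|rewrite addrC subrK].
Qed.

End PrimaryDecomposition.

(** * From algebraic submodules to topological ones *)

Section Cyclic.
Variables (M : topologicalZmodType) (al be : M -> M) (O : set M).
Hypothesis L : contraction_lattice al be O.
Hypotheses (cal : continuous al) (cbe : continuous be).
Hypothesis nO : nbhs (0 : M) O.
Hypothesis basisO : forall V, nbhs (0 : M) V ->
  exists n : nat, forall x, O (zpow al be (- n%:Z) x) -> V x.
Local Notation P := (zpow al be).

Let alK := lat_alK L.
Let beK := lat_beK L.
Let PD := zpowD alK beK.
Let zpow_add := zpow_morphD (lat_morph L) alK beK.
Let zpow0r := zpow_morph0 (lat_morph L) alK beK.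
Let zpowB := zpow_morphB (lat_morph L) alK beK.
Let cP := zpow_continuous cal cbe alK beK.

Lemma nbhs_lat j (x : M) : nbhs x [set y | O (P j (y - x))].
Proof.
apply/nbhsE0; have : nbhs (0 : M) (P j @^-1` O) by apply: cP; rewrite zpow0r.
by apply: filterS => y /=; rewrite addrC addKr.
Qed.

Lemma nbhs_latE (x : M) V : nbhs x V ->
  exists n : nat, forall y, O (P (- n%:Z) y) -> V (x + y).
Proof. by move=> /nbhsE0 /basisO. Qed.

Lemma psub_closed_submodule H :
  power_submodule al be O H -> closed_submodule al H.
Proof.
move=> sH; split; last split; last split.
- move=> y clH; apply: (psub_closed L sH) => n.
  have [h [Hh Oh]] := clH _ (nbhs_lat (- n%:Z) y); exists h => //.
  by rewrite -opprB (zpow_morphN (lat_morph L) alK beK); exact: (latN L).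
- exact: (psub0 sH).
- exact: (psubB sH).
- by move=> x; split; [exact: (psub_al L sH)|exact: (psub_be sH)].
Qed.

Lemma psub_direct_sum A B :
  power_submodule al be O A -> power_submodule al be O B ->
  (forall y, A y -> B y -> y = 0) -> (forall y, sum_set A B y) ->
  topological_direct_sum A B.
Proof.
move=> sA sB AB0 AB; split.
  apply/seteqP; split=> [y [Ay By]|y ->]; first exact: AB0.
  by split; [exact: (psub0 sA)|exact: (psub0 sB)].
split.
  move=> y; have [a Aa Ba] := AB y; exists a, (y - a).
  by rewrite [a + _]addrC subrK.
have /choice[pr Hpr] y : exists a, A a /\ B (y - a).
  by have [a Aa Ba] := AB y; exists a.
exists pr => // y V /nbhs_latE[n Vn].
(* If [z - y] is in [al^(n+k) O], its component in [A] is [al^(n+k) a] with [al^k a] in [O], hence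
   lies in [al^n O]. *)
have [k Hk] := lat_split L sA sB AB.
have := nbhs_lat (- (n + k)%N%:Z) y; apply: filterS => z /Hk[a [Aa Ba Oa _]].
have prz : pr z = pr y + P (n + k)%N a.
  apply/eqP; rewrite -subr_eq0; apply/eqP.
  have [Az Bz] := Hpr z; have [Ay By] := Hpr y.
  apply: AB0.
    apply: (psubB sA) => //; apply: (psubD sA) => //.
    exact/(psub_zpow L sA).
  have -> : pr z - (pr y + P (n + k)%N a) =
      P (n + k)%N (P (- (n + k)%N%:Z) (z - y) - a) - ((z - pr z) - (y - pr y)).
    rewrite zpowB (zpowVK alK beK).
    have -> : z - y = (z - pr z) - (y - pr y) + (pr z - pr y).
      by rewrite addrACA subrK -opprD subrK.
    set T := (z - pr z) - _.
    by rewrite [T + _]addrC addrAC addrK opprD addrA.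
  apply: (psubB sB); last exact: (psubB sB).
  exact/(psub_zpow L sB).
rewrite /= prz; apply: Vn; rewrite -PD.
by have -> : - n%:Z + (n + k)%N = k by lia.
Qed.

(** * Laurent coefficients with respect to a free generator *)

Section LaurentDigits.
Variables (p n : nat) (x : M).
Hypotheses (p_pr : prime p) (pn0 : forall y : M, y *+ (p ^ n.+1) = 0).
Hypothesis (xn : x *+ (p ^ n) <> 0).
Hypothesis (Ox : O x).
Hypothesis (cyc : forall y, cyclic_sub al be O x y).

Local Notation q := (p ^ n.+1)%N.

Lemma q_gt1 : (1 < q)%N.
Proof. by rewrite -{1}(expn0 p) ltn_exp2l // prime_gt1. Qed.

Lemma q_cast : (Zp_trunc q).+2 = q. Proof. exact: Zp_cast q_gt1. Qed.

Lemma modn_q k : (k %% (Zp_trunc q).+2 = k %% q)%N.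
Proof. by rewrite q_cast. Qed.

(** Coefficients of [t^k f] in degrees [i >= 0], as natural representatives. *)
Definition digits (k : int) (f : int -> 'Z_q) (i : nat) : nat := f (i%:Z - k).

(* [f] is the Laurent expansion of [y]: [y = sum_j f_j al^j x], the sum being
   made into a power series by multiplication with [al^k], [k] large. *)
Definition expansion (y : M) (f : int -> 'Z_q) : Prop :=
  exists k0 : int, forall k : int, k0 <= k ->
    (forall j, j < - k -> f j = 0) /\ P k y = act al be O (digits k f) x.

Lemma digits_shift f (k k' : int) : (forall j, j < - k -> f j = 0) -> k <= k' ->
  act al be O (digits k' f) x = P (k' - k) (act al be O (digits k f) x).
Proof.
move=> fk kk'; have -> : k' = k + `|k' - k|%N by lia.
elim: `|k' - k|%N => [|d IHd]; first by rewrite addr0 subrr.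
rewrite (act_step L) (_ : digits _ f 0%N = 0%N); last first.
  by rewrite /digits fk //; lia.
rewrite mulr0n add0r (_ : (fun i => _) = digits (k + d) f); last first.
  by apply: funext => i; rewrite /digits; do 2 congr (_ _); lia.
by rewrite IHd -(zpowS beK); congr (P _ _); lia.
Qed.

Lemma expansionI y f (k : int) : (forall j, j < - k -> f j = 0) ->
  P k y = act al be O (digits k f) x -> expansion y f.
Proof.
move=> fk yk; exists k => k' kk'; split; first by move=> j jk; apply: fk; lia.
by rewrite (digits_shift fk kk') -yk -PD; congr (P _ _); lia.
Qed.

Lemma expansion_at y f (k : int) :
  expansion y f -> (forall j, j < - k -> f j = 0) ->
  P k y = act al be O (digits k f) x.
Proof.
move=> [k0 H] fk; pose k' := Num.max k k0.
have [|_ yk'] := H k'; first by rewrite /k'; lia.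
have kk' : k <= k' by rewrite /k'; lia.
apply: (can_inj (zpowK alK beK (k' - k))); rewrite -digits_shift // -yk' -PD.
by congr (P _ _); lia.
Qed.

Lemma expansion_zpow y a (k : int) : P k y = act al be O a x ->
  expansion y (fun j => if 0 <= j + k then inZp (a (absz (j + k))) else 0).
Proof.
move=> yk; apply: (@expansionI _ _ k).
  by move=> j jk; rewrite leNgt (_ : j + k < 0) //; lia.
rewrite yk; apply: (eq_act L) => i.
rewrite /digits subrK /= -(mulrn_modn (a i) (pn0 x)).
by rewrite modn_q.
Qed.

Lemma expansion_unique y f g : expansion y f -> expansion y g -> f = g.
Proof.
move=> [k Hk] [l Hl]; pose K := Num.max k l.
have [|fK yf] := Hk K; first by rewrite /K; lia.
have [|gK yg] := Hl K; first by rewrite /K; lia.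
apply: funext => j; have [jK|jK] := ltP j (- K); first by rewrite fK ?gK.
pose i := absz (j + K); have jE : j = i%:Z - K by rewrite /i; lia.
(* [h] represents the difference of the two expansions, so freeness makes [q] divide each [h i]. *)
pose h i := (digits K f i + q.-1 * digits K g i)%N.
have /(act_inj L p_pr pn0 xn)/(_ i) : act al be O h x = 0.
  rewrite (act_addl L) (act_mull L) -yf yg -mulrS prednK ?pn0 //.
  exact: ltnW q_gt1.
rewrite /h /digits -jE => qh; apply: val_inj => /=.
have fq : (f j < q)%N by rewrite -[X in (_ < X)%N]q_cast.
have gq : (g j < q)%N by rewrite -[X in (_ < X)%N]q_cast.
have : (f j = g j %[mod q])%N.
  apply/eqP; rewrite -(eqn_modDr (q.-1 * g j)); rewrite (eqP qh).
  by rewrite -mulSn prednK ?modnMr // ltnW // q_gt1.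
by rewrite !modn_small.
Qed.

Lemma expansion_inj y z f : expansion y f -> expansion z f -> y = z.
Proof.
move=> [k Hk] [l Hl]; pose K := Num.max k l.
have [|fK yf] := Hk K; first by rewrite /K; lia.
have [|gK zf] := Hl K; first by rewrite /K; lia.
by apply: (can_inj (zpowK alK beK K)); rewrite yf zf.
Qed.

Lemma expansionD y z f g : expansion y f -> expansion z g ->
  expansion (y + z) (fun j => f j + g j).
Proof.
move=> [k Hk] [l Hl]; pose K := Num.max k l.
have [|fK yf] := Hk K; first by rewrite /K; lia.
have [|gK zg] := Hl K; first by rewrite /K; lia.
apply: (@expansionI _ _ K) => [j jK|]; first by rewrite fK ?gK ?addr0.
rewrite zpow_add yf zg -(act_addl L); apply: (eq_act L) => i.
rewrite /digits /= -(mulrn_modn (_ + _) (pn0 x)).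
by rewrite modn_q.
Qed.

Lemma expansion_al y f : expansion y f -> expansion (al y) (fun j => f (j - 1)).
Proof.
move=> [k Hk]; have [|fk yf] := Hk (k + 1); first by lia.
apply: (@expansionI _ _ k) => [j jk|]; first by apply: fk; lia.
rewrite -(zpow1 al be) -PD yf; congr act; apply: funext => i.
by rewrite /digits; do 2 congr (_ _); lia.
Qed.

Lemma laurent_iso : exists phi : M -> int -> 'Z_q, laurent_module_iso al phi.
Proof.
have /choice[phi Hphi] y : exists f, expansion y f.
  by have [k [a ya]] := cyc y; eexists; exact: expansion_zpow ya.
have phiE y f : expansion y f -> phi y = f by exact: expansion_unique.
have phiD y z j : phi (y + z) j = phi y j + phi z j.
  by rewrite (phiE _ _ (expansionD (Hphi y) (Hphi z))).
exists phi; split=> //; split.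
  move=> y; have [k0 Hk] := Hphi y; have [|fk _] := Hk k0; first by [].
  by exists (- k0).
split.
  by move=> y z yz; apply: (expansion_inj (Hphi y)); rewrite yz; exact: Hphi.
split.
  move=> f [k fk]; exists (P k (act al be O (digits (- k) f) x)).
  apply: phiE; apply: (@expansionI _ _ (- k)); first by rewrite opprK.
  by rewrite (zpowK alK beK).
split; first by move=> y j; rewrite (phiE _ _ (expansion_al (Hphi y))).
split.
- move=> y k.
  (* Expansions of elements of [O] start in degree at least [-K], so differences in [al^(|k|+K) O]
     have no coefficient below [k]. *)
  have [K HK] : exists K : nat,
      O `<=` [set y | exists a, P K y = act al be O a x].
    apply: (lat_bounded L).
    + by move=> l; exists (fun=> 0%N); rewrite (act_zero L) zpow0r.
    + move=> l u v [a ua] [b vb]; exists (fun i => (a i + b i)%N).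
      by rewrite zpow_add ua vb (act_addl L).
    + move=> l c u [a ua]; exists (cauchy_prod a c).
      by rewrite -(act_zpow L) ua (act_act L).
    + move=> l l' ll' u [a ua]; have [b Eb] := act_shift L (l' - l)%N a x.
      by exists b; rewrite -Eb -ua -PD; congr (P _ _); lia.
    + by move=> u _; have [l [a ua]] := cyc u; exists l, a.
  have := nbhs_lat (- (`|k| + K)%N%:Z) y; apply: filterS => z /HK[a za] j jk.
  rewrite -PD in za; have -> : z = y + (z - y) by rewrite addrC subrK.
  rewrite phiD (phiE _ _ (expansion_zpow za)) leNgt.
  by rewrite (_ : j + _ < 0) ?addr0 //; lia.
(* As [x] is in [O], a series without terms below [t^k] sends [x] into [al^k O]. *)
- move=> y V /nbhs_latE[k Vk]; exists k => z Hz.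
  have -> : z = y + (z - y) by rewrite addrC subrK.
  apply: Vk; rewrite (expansion_at (Hphi (z - y))); first exact: (act_lat L).
  move=> j; rewrite opprK => jk; have /(_ j jk) Hj := Hz.
  by rewrite -(addrK (phi y j) (phi (z - y) j)) -phiD subrK Hj subrr.
Qed.

End LaurentDigits.

End Cyclic.

Theorem mainTheorem12 (M : topologicalZmodType) (alpha : M -> M) (m : nat) :
  LCA_group M ->
  topological_automorphism alpha ->
  contracting alpha ->
  (exists x : M, x != 0) ->
  (1 <= m)%N -> (forall x : M, x *+ m = 0) ->
  indecomposable alpha ->
  exists (p n : nat), [/\ prime p, (1 <= n)%N &
    exists phi : M -> int -> 'Z_(p ^ n), laurent_module_iso alpha phi].
Proof.
move=> [hM lc] aut contr M0 m0 m_tors ind.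
have [p [n [p_pr pn0 [x0 x0n]]]] :=
  indecomposable_exponent hM aut ind M0 m0 m_tors.
have [alD [cal [be cbe [alK beK]]]] := aut.
have [V V0 cV] := lc 0.
have [K [cK K0 KB]] := bounded_compact_open_subgroup hM cV V0 m0 m_tors.
have [W L [nW basis]] :=
  contraction_latticeP hM alD cal cbe alK beK contr cK K0 KB.
(* [x0] is moved into [O] by a power of [alpha], which preserves its order. *)
have [k Ok] := lat_absorb L x0; pose x := zpow alpha be k x0.
have xn : x *+ (p ^ n) <> 0.
  rewrite -(zpow_morphMn alD alK beK) => H; apply: x0n.
  by apply: (can_inj (zpowK alK beK k)); rewrite (zpow_morph0 alD alK beK).
have [N sN [NC NCM]] := cyclic_complement L p_pr pn0 xn.
exists p, n.+1; split=> //.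
apply: (laurent_iso L cal cbe nW basis p_pr pn0 xn Ok).
(* The summand generated by [x] is nonzero, so indecomposability kills its complement [N]. *)
suff N0 y : N y -> y = 0.
  by move=> y; have [a Na] := NCM y; rewrite (N0 a Na) subr0.
move=> Ny; apply: contrapT => y0; apply: ind.
have sC : power_submodule alpha be W (cyclic_sub alpha be W x).
  by apply: (psub_cyclic L) (pn0 x); rewrite expn_gt0 prime_gt0.
exists N, (cyclic_sub alpha be W x); split.
- exact: (psub_closed_submodule L).
- exact: (psub_closed_submodule L).
- by exists y => //; exact/eqP.
- exists x; first exact: (cyclic_self L).
  by apply/eqP => x00; apply: xn; rewrite x00 mul0rn.
- exact: (psub_direct_sum L).
Qed.
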